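(* Let $\mathcal C\subset\mathbb R^n$ be nonempty, compact and convex; let $f:\mathbb R^n\to\mathbb R$ be continuously differentiable on an open set containing $\mathcal C$ with $\nabla f$ Lipschitz-continuous on $\mathcal C$; let $T:\mathbb R^n\to\mathbb R^m$ be linear; let $\mathcal D\subset\mathbb R^m$ be nonempty, closed and convex with $\mathcal D\cap T(\mathcal C)\ne\varnothing$; let $g=\iota_{\mathcal D}$ and $\widetilde{\mathcal C}:=\mathcal C\cap T^{-1}(\mathcal D)$. Suppose there is $\kappa_{\mathrm{ind}}>0$ such that $\mathrm{dist}_{\widetilde{\mathcal C}}(x)\le\kappa_{\mathrm{ind}}\,\mathrm{dist}_{\mathcal D}(Tx)$ for every $x\in\mathcal C$. Let $(x_k)_{k\in\mathbb N}$ be generated by FRAMES with $\gamma_k=(k+1)^{-1/2}$ and $\beta_k=\beta_0(k+1)^{-1/4}$, $\beta_0>0$. For $N\ge2$ let $k_N^*\in\operatorname{argmin}_{\lfloor N/2\rfloor\le k\le N-1}\mathrm{gap}^{\beta_k}(x_k)$. Then $$\mathrm{dist}_{\mathcal D}(Tx_{k_N^*})=\mathcal O(N^{-1/4})\qquad\text{and}\qquad\left|\widetilde{\mathrm{gap}}(x_{k_N^*})\right|=\mathcal O(N^{-1/4}).$$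
   Context: $\iota_{\mathcal D}$ is $0$ on $\mathcal D$ and $+\infty$ elsewhere; $\mathrm{dist}_S(y)=\inf_{u\in S}\|y-u\|_2$. For $\beta>0$ the Moreau envelope is $g^\beta(y)=\min_u\{g(u)+\frac1{2\beta}\|u-y\|_2^2\}=\frac1{2\beta}\mathrm{dist}_{\mathcal D}^2(y)$, with $\nabla g^\beta(y)=\beta^{-1}(y-\mathrm{proj}_{\mathcal D}(y))$. Smoothed Frank-Wolfe gap: for $x\in\mathcal C$, $\mathrm{gap}^\beta(x):=\max_{s\in\mathcal C}\langle\nabla f(x)+T^*\nabla g^\beta(Tx),x-s\rangle$. Signed nonsmooth Frank-Wolfe gap: $\widetilde{\mathrm{gap}}(x):=\max_{s\in\widetilde{\mathcal C}}\langle\nabla f(x),x-s\rangle$. FRAMES: given $x_0\in\mathcal C$, step sizes $\gamma_k\in\,]0,1]$ and smoothing parameters $\beta_k>0$, for $k=0,1,2,\dots$ let $\Phi_k(x)=f(x)+g^{\beta_k}(Tx)$, choose any $s_k\in\operatorname{argmin}_{s\in\mathcal C}\langle\nabla\Phi_k(x_k),s\rangle$, and set $x_{k+1}=x_k+\gamma_k(s_k-x_k)$. $\mathcal O(N^{-1/4})$ means bounded by a constant independent of $N$ times $N^{-1/4}$. *)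

(* Defs.v *)
From mathcomp Require Import all_boot all_order all_algebra.
From mathcomp Require Import all_classical all_reals all_analysis.

Set Implicit Arguments.
Unset Strict Implicit.
Unset Printing Implicit Defensive.

Import Order.TTheory GRing.Theory Num.Theory.
Import numFieldNormedType.Exports.

Local Open Scope classical_set_scope.
Local Open Scope ring_scope.

(* R^n is 'rV[R]_n.  The library norm `|x| on it is the sup norm, which yields
   the usual topology (open, closed, compact, differentiable); the metric
   quantities below use the Euclidean norm [norm2]. *)

Definition dotv (R : realType) (n : nat) (u v : 'rV[R]_n) : R :=
  \sum_(i < n) u 0 i * v 0 i.

Definition norm2 (R : realType) (n : nat) (u : 'rV[R]_n) : R :=
  Num.sqrt (dotv u u).

Definition dist2 (R : realType) (n : nat) (S : set 'rV[R]_n) (y : 'rV[R]_n) : R :=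
  inf [set norm2 (y - u) | u in S].

Definition grad (R : realType) (n : nat) (f : 'rV[R]_n -> R) (x : 'rV[R]_n)
  : 'rV[R]_n :=
  \row_(i < n) 'D_(delta_mx 0 i) f x.

Definition continuously_differentiable_on (R : realType) (n : nat)
    (U : set 'rV[R]_n) (f : 'rV[R]_n -> R) : Prop :=
  (forall x, U x -> differentiable f x) /\ {within U, continuous (grad f)}.

Definition lipschitz2_on (R : realType) (n p : nat) (A : set 'rV[R]_n)
    (F : 'rV[R]_n -> 'rV[R]_p) : Prop :=
  exists L : R, forall x y, A x -> A y ->
    norm2 (F x - F y) <= L * norm2 (x - y).

(* [lin1_mx T] satisfies [x *m lin1_mx T = T x], so its transpose represents
   the adjoint: dotv (T x) y = dotv x (adjoint T y). *)
Definition adjoint (R : realType) (n m : nat)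
    (T : {linear 'rV[R]_n -> 'rV[R]_m}) (y : 'rV[R]_m) : 'rV[R]_n :=
  y *m (lin1_mx T)^T.

Definition argmin (R : realType) (X : Type) (A : set X) (h : X -> R) : set X :=
  [set x | A x /\ forall y, A y -> h x <= h y].

Definition indic_fun (R : realType) (m : nat) (D : set 'rV[R]_m) (y : 'rV[R]_m)
  : \bar R :=
  if y \in D then 0%E else +oo%E.

(* The infimum is finite and attained when [g] is the indicator of a nonempty
   closed set and [0 < beta]. *)
Definition moreau (R : realType) (m : nat) (g : 'rV[R]_m -> \bar R) (beta : R)
    (y : 'rV[R]_m) : R :=
  fine (ereal_inf
    [set (g u + ((2 * beta)^-1 * norm2 (u - y) ^+ 2)%:E)%E | u in setT]).

(* In both gaps the set over which [sup] is taken is the image of a nonempty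
   compact set under a continuous function, so that [sup] is a maximum. *)
Definition smoothed_gap (R : realType) (n m : nat) (C : set 'rV[R]_n)
    (f : 'rV[R]_n -> R) (T : {linear 'rV[R]_n -> 'rV[R]_m})
    (g : 'rV[R]_m -> \bar R) (beta : R) (x : 'rV[R]_n) : R :=
  sup [set dotv (grad f x + adjoint T (grad (moreau g beta) (T x))) (x - s)
      | s in C].

Definition signed_gap (R : realType) (n : nat) (Ct : set 'rV[R]_n)
    (f : 'rV[R]_n -> R) (x : 'rV[R]_n) : R :=
  sup [set dotv (grad f x) (x - s) | s in Ct].

Definition smoothed_obj (R : realType) (n m : nat) (f : 'rV[R]_n -> R)
    (T : {linear 'rV[R]_n -> 'rV[R]_m}) (g : 'rV[R]_m -> \bar R) (beta : R)
    (x : 'rV[R]_n) : R :=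
  f x + moreau g beta (T x).

Definition frames (R : realType) (n m : nat) (C : set 'rV[R]_n)
    (f : 'rV[R]_n -> R) (T : {linear 'rV[R]_n -> 'rV[R]_m})
    (g : 'rV[R]_m -> \bar R) (gamma beta : nat -> R) (x : nat -> 'rV[R]_n)
  : Prop :=
  [/\ C (x 0%N),
      forall k, 0 < gamma k <= 1,
      forall k, 0 < beta k
    & forall k, exists2 s : 'rV[R]_n,
        argmin C (dotv (grad (smoothed_obj f T g (beta k)) (x k))) s
      & x k.+1 = x k + gamma k *: (s - x k)].

(* Main.v *)
(* Write d(z) for the distance from T z to D and u(z) = T z - proj_D(T z).  The
   function d^2 / 2 satisfies <u(z), T v> <= d(z + v)^2 / 2 - d(z)^2 / 2 <=
   <u(z), T v> + |T v|^2 / 2, which gives both the gradient of the Moreau envelope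
   and the descent inequality of a Frank-Wolfe step, with an error
   O(gamma_k^2 / beta_k).  Telescoping over [N/2, N) bounds the smallest smoothed
   gap by O(N^(-1/4)).  Conversely, testing the smoothed gap at z with
   s in C with T s in D gives <grad f(z), z - s> + d(z)^2 / beta <= gap; choosing s
   almost nearest to z, the regularity hypothesis makes the first term at least
   - O(d(z)), whence a quadratic inequality for d(z).  The same inequality bounds
   the signed gap from above, and its near-nearest test point from below. *)
Require Import Defs.
From mathcomp Require Import all_boot all_order all_algebra.
From mathcomp Require Import all_classical all_reals all_analysis.
From mathcomp Require Import ring lra zify.

Set Implicit Arguments.
Unset Strict Implicit.
Unset Printing Implicit Defensive.

Import Order.TTheory GRing.Theory Num.Theory.
Import numFieldNormedType.Exports.

Local Open Scope classical_set_scope.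
Local Open Scope ring_scope.

(** * Euclidean inner product and norm, compared with the sup norm *)

Section Euclidean.
Context {R : realType}.

Lemma dotvC n (u v : 'rV[R]_n) : dotv u v = dotv v u.
Proof. by apply: eq_bigr => i _; rewrite mulrC. Qed.

Lemma dotvDl n (u v w : 'rV[R]_n) : dotv (u + v) w = dotv u w + dotv v w.
Proof. by rewrite -big_split; apply: eq_bigr => i _; rewrite mxE mulrDl. Qed.

Lemma dotvZl n a (u v : 'rV[R]_n) : dotv (a *: u) v = a * dotv u v.
Proof. by rewrite mulr_sumr; apply: eq_bigr => i _; rewrite mxE mulrA. Qed.

Lemma dotvNl n (u v : 'rV[R]_n) : dotv (- u) v = - dotv u v.
Proof. by rewrite -scaleN1r dotvZl mulN1r. Qed.

Lemma dotvDr n (u v w : 'rV[R]_n) : dotv u (v + w) = dotv u v + dotv u w.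
Proof. by rewrite ![dotv u _]dotvC dotvDl. Qed.

Lemma dotvZr n a (u v : 'rV[R]_n) : dotv u (a *: v) = a * dotv u v.
Proof. by rewrite ![dotv u _]dotvC dotvZl. Qed.

Lemma dotvNr n (u v : 'rV[R]_n) : dotv u (- v) = - dotv u v.
Proof. by rewrite ![dotv u _]dotvC dotvNl. Qed.

Definition dotvE := (dotvDl, dotvDr, dotvZl, dotvZr, dotvNl, dotvNr).

Lemma dotv0 n (u : 'rV[R]_n) : dotv u 0 = 0.
Proof. by rewrite -(scale0r 0) dotvZr mul0r. Qed.

Lemma dotv_ge0 n (u : 'rV[R]_n) : 0 <= dotv u u.
Proof. by apply: sumr_ge0 => i _; rewrite -expr2 sqr_ge0. Qed.

Lemma dotv_delta n (i : 'I_n) (u : 'rV[R]_n) : dotv (delta_mx 0 i) u = u 0 i.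
Proof.
rewrite /dotv (bigD1 i)//= mxE !eqxx mul1r big1 ?addr0// => j ji.
by rewrite mxE eqxx (negbTE ji) mul0r.
Qed.

Lemma norm2_ge0 n (u : 'rV[R]_n) : 0 <= norm2 u.
Proof. exact: sqrtr_ge0. Qed.

Lemma norm2_sq n (u : 'rV[R]_n) : norm2 u ^+ 2 = dotv u u.
Proof. by rewrite sqr_sqrtr// dotv_ge0. Qed.

Lemma norm2N n (u : 'rV[R]_n) : norm2 (- u) = norm2 u.
Proof. by rewrite /norm2 dotvNl dotvNr opprK. Qed.

Lemma norm2Z n a (u : 'rV[R]_n) : norm2 (a *: u) = `|a| * norm2 u.
Proof.
by rewrite /norm2 dotvZl dotvZr mulrA -expr2 sqrtrM ?sqr_ge0// sqrtr_sqr.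
Qed.

Lemma norm2_eq0 n (u : 'rV[R]_n) : norm2 u = 0 -> u = 0.
Proof.
move=> u0; have /eqP : dotv u u = 0 by rewrite -norm2_sq u0 expr0n.
rewrite psumr_eq0 => [/allP h|i _]; last by rewrite -expr2 sqr_ge0.
apply/rowP => i; have := h i (mem_index_enum _).
by rewrite /= mulf_eq0 orbb mxE => /eqP.
Qed.

(** For nonzero norms, expand the square of [norm2 v *: u - norm2 u *: v] and cancel the factor
    [norm2 u * norm2 v]. *)
Lemma cauchy_schwarz n (u v : 'rV[R]_n) : dotv u v <= norm2 u * norm2 v.
Proof.
have [/norm2_eq0->|u0] := eqVneq (norm2 u) 0.
  by rewrite dotvC dotv0 mulr_ge0 ?norm2_ge0.
have [/norm2_eq0->|v0] := eqVneq (norm2 v) 0.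
  by rewrite dotv0 mulr_ge0 ?norm2_ge0.
have uv : 0 < norm2 u * norm2 v by rewrite mulr_gt0// lt0r ?u0 ?v0 norm2_ge0.
have := dotv_ge0 (norm2 v *: u - norm2 u *: v).
rewrite !dotvE -!norm2_sq (dotvC v u) => h.
by rewrite -(ler_pM2l uv); nra.
Qed.

Lemma norm2D n (u v : 'rV[R]_n) : norm2 (u + v) <= norm2 u + norm2 v.
Proof.
rewrite -(@ler_pXn2r _ 2) ?nnegrE ?addr_ge0 ?norm2_ge0//.
rewrite norm2_sq !dotvE (dotvC v u) -!norm2_sq.
by have := cauchy_schwarz u v; nra.
Qed.

Lemma ler_coord_norm2 n (u : 'rV[R]_n) i : `|u 0 i| <= norm2 u.
Proof.
rewrite -sqrtr_sqr ler_wsqrtr// /dotv (bigD1 i)//= -expr2 lerDl.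
by apply: sumr_ge0 => j _; rewrite -expr2 sqr_ge0.
Qed.

Lemma ler_norm_norm2 n (u : 'rV[R]_n) : `|u| <= norm2 u.
Proof.
rewrite /Num.norm/= mx_normrE; apply/bigmax_leP; split; first exact: norm2_ge0.
by move=> [i j] _ /=; rewrite ord1 ler_coord_norm2.
Qed.

Lemma ler_coord_norm n (u : 'rV[R]_n) i : `|u 0 i| <= `|u|.
Proof.
rewrite [leRHS]/Num.norm/= mx_normrE; apply/bigmax_geP; right.
by exists (0, i).
Qed.

(** Carries boundedness from the sup norm to the Euclidean one: each of the [n] squares is at most
    the squared sup norm, and n <= n^2. *)
Lemma ler_norm2_norm n (u : 'rV[R]_n) : norm2 u <= n%:R * `|u|.
Proof.
have nu : 0 <= n%:R * `|u| by rewrite mulr_ge0.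
rewrite -(@ler_pXn2r _ 2) ?nnegrE ?norm2_ge0// norm2_sq.
apply: (@le_trans _ _ (n%:R * `|u| ^+ 2)).
  rewrite mulr_natl -[X in _ *+ X]card_ord -sumr_const; apply: ler_sum => i _.
  by rewrite -expr2 -real_normK ?num_real// ler_pXn2r ?nnegrE// ler_coord_norm.
rewrite exprMn ler_wpM2r ?sqr_ge0// -natrX ler_nat.
by case: (n) => // k; rewrite -mulnn leq_pmulr.
Qed.

Lemma dotv_continuous n (v : 'rV[R]_n) :
  continuous (fun u : 'rV[R]_n => dotv (v - u) (v - u)).
Proof.
rewrite /dotv; apply: continuous_big => [|i _ u]; first exact: add_continuous.
have h : {for u, continuous (fun w : 'rV[R]_n => (v - w) 0 i)}.
  rewrite (_ : (fun _ => _) = cst (v 0 i) - (fun w : 'rV[R]_n => w 0 i)).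
    by apply: continuousB; [exact: cst_continuous|exact: coord_continuous].
  by apply/funext => w; rewrite !mxE.
exact: (continuousM h h).
Qed.

Lemma norm2_continuous n (v : 'rV[R]_n) :
  continuous (fun u : 'rV[R]_n => norm2 (v - u)).
Proof.
move=> u.
apply: (@continuous_comp _ _ _ (fun w : 'rV[R]_n => dotv (v - w) (v - w))).
  exact: dotv_continuous.
exact: sqrt_continuous.
Qed.

Lemma dotv_adjoint n m (T : {linear 'rV[R]_n -> 'rV[R]_m}) u y :
  dotv u (adjoint T y) = dotv (T u) y.
Proof.
rewrite -[T u](mul_rV_lin1 T) /dotv /adjoint.
under eq_bigr do rewrite mxE mulr_sumr.
rewrite exchange_big/=; apply: eq_bigr => j _; rewrite !mxE mulr_suml.
by apply: eq_bigr => i _; rewrite !mxE; ring.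
Qed.

(** K is the sum of the norms of the columns of the matrix: Cauchy-Schwarz bounds each coordinate of
    [T u], and the Euclidean norm is at most the sum of the absolute coordinates. *)
Lemma linear_norm2_bounded n m (T : {linear 'rV[R]_n -> 'rV[R]_m}) :
  exists2 K, 0 <= K & forall u, norm2 (T u) <= K * norm2 u.
Proof.
pose c j := norm2 (col j (lin1_mx T))^T.
exists (\sum_j c j) => [|u]; first by apply: sumr_ge0 => j _; exact: norm2_ge0.
have cE j : `|T u 0 j| <= c j * norm2 u.
  have -> : T u 0 j = dotv u (col j (lin1_mx T))^T.
    by rewrite -(mul_rV_lin1 T) mxE; apply: eq_bigr => i _; rewrite !mxE.
  rewrite ler_norml mulrC cauchy_schwarz andbT lerNl -dotvNl -(norm2N u).
  exact: cauchy_schwarz.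
have h : norm2 (T u) ^+ 2 <= (\sum_j `|T u 0 j|) ^+ 2.
  rewrite norm2_sq [leRHS]expr2 mulr_suml; apply: ler_sum => j _.
  rewrite -expr2 -real_normK ?num_real// expr2 ler_wpM2l// (bigD1 j)//= lerDl.
  exact: sumr_ge0.
rewrite ler_pXn2r ?nnegrE ?norm2_ge0 ?sumr_ge0// in h.
apply: le_trans h _; rewrite mulr_suml; exact: ler_sum.
Qed.

End Euclidean.

(** * Distance to a set and projection on a closed convex set *)

Section Projection.
Context {R : realType} {m : nat}.
Variable D : set 'rV[R]_m.

Lemma dist2_lb y u : D u -> dist2 D y <= norm2 (y - u).
Proof.
move=> Du; apply: ge_inf; last by exists u.
by exists 0 => _ [w _ <-]; exact: norm2_ge0.
Qed.

Lemma dist2_ge0 y : 0 <= dist2 D y.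
Proof.
have [->|/set0P[u Du]] := eqVneq D set0; first by rewrite /dist2 image_set0 inf0.
apply: lb_le_inf; first by exists (norm2 (y - u)), u.
by move=> _ [w _ <-]; exact: norm2_ge0.
Qed.

Lemma dist2_adherent y e : D !=set0 -> 0 < e ->
  exists2 u, D u & norm2 (y - u) < dist2 D y + e.
Proof.
move=> [u Du] e0.
have [|_ [w Dw <-] h] := @inf_adherent R [set norm2 (y - u) | u in D] e e0.
  split; first by exists (norm2 (y - u)), u.
  by exists 0 => _ [w _ <-]; exact: norm2_ge0.
by exists w.
Qed.

(** [xget] returns a minimiser whenever one exists, and the default 0 otherwise. *)
Definition proj2 y := xget 0 (argmin D (fun u => norm2 (y - u))).

(** The points of [D] no farther from [y] than a fixed [u] in [D] form a compact set, on which the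
    continuous distance attains its minimum; all other points of [D] are farther than [u]. *)
Lemma proj2P y : D !=set0 -> closed D ->
  argmin D (fun u => norm2 (y - u)) (proj2 y).
Proof.
move=> [u Du] clD; apply: xgetPex.
pose K := D `&` (fun w => norm2 (y - w)) @^-1` [set r | r <= norm2 (y - u)].
have cK : compact K.
  apply: bounded_closed_compact.
    exists (`|y| + norm2 (y - u)); split; first exact: num_real.
    move=> M hM w [_ /= yw]; rewrite -[w](subKr y) ltW//.
    apply: le_lt_trans (ler_normB _ _) (le_lt_trans _ hM).
    by rewrite lerD2l (le_trans (ler_norm_norm2 _)).
  apply: closedI => //; apply: closed_comp; last exact: closed_le.
  by move=> w _; exact: norm2_continuous.
have K0 : K !=set0 by exists u; split => /=.
have cn : {within K, continuous (fun w : 'rV[R]_m => norm2 (y - w))}.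
  exact/continuous_subspaceT/norm2_continuous.
have [p /set_mem[Dp yp] pmin] := EVT_min_rV K0 cK cn.
exists p; split => // w Dw.
have [h|h] := leP (norm2 (y - w)) (norm2 (y - u)).
  by apply: pmin; apply/mem_set; split.
exact: le_trans yp (ltW h).
Qed.

Lemma dist2_proj2 y : D !=set0 -> closed D -> dist2 D y = norm2 (y - proj2 y).
Proof.
move=> D0 clD; have [Dp pmin] := proj2P y D0 clD.
apply/eqP; rewrite eq_le dist2_lb//=; apply: lb_le_inf.
  by exists (norm2 (y - proj2 y)), (proj2 y).
by move=> _ [w Dw <-]; exact: pmin.
Qed.

Lemma convex_segment (A : set 'rV[R]_m) a b (t : R) : convex_set A ->
  A a -> A b -> 0 <= t <= 1 -> A (a + t *: (b - a)).
Proof.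
move=> cA Aa Ab /andP[t0 t1]; have := cA b a (Itv01 t0 t1).
move=> /(_ (mem_set Ab) (mem_set Aa)) /set_mem.
congr (A _); rewrite /conv /=.
by rewrite scalerBl scale1r scalerBr addrC -!addrA [- _ + _]addrC.
Qed.

(** Comparing p with p + t (u - p) gives 2a <= t b for every t in ]0,1]; if a were positive, t = a /
    (a + b) would contradict this. *)
Lemma proj2_obtuse y u : D !=set0 -> closed D -> convex_set D -> D u ->
  dotv (y - proj2 y) (u - proj2 y) <= 0.
Proof.
move=> D0 clD cD Du; have [Dp pmin] := proj2P y D0 clD.
set p := proj2 y in Dp pmin *; set a := dotv _ _.
pose b := dotv (u - p) (u - p).
have b0 : 0 <= b by exact: dotv_ge0.
have key t : 0 < t -> t <= 1 -> 2 * a <= t * b.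
  move=> t0 t1; have := pmin _ (convex_segment cD Dp Du (_ : 0 <= t <= 1)).
  rewrite t1 (ltW t0) => /(_ isT).
  rewrite -(@ler_pXn2r _ 2) ?nnegrE ?norm2_ge0// !norm2_sq opprD addrA.
  rewrite !(dotvDl (y - p), dotvDr _ (y - p)) !dotvNr !dotvNl !dotvZr !dotvZl.
  by rewrite (dotvC (u - p) (y - p)) -/a -/b => h; rewrite -(ler_pM2l t0); nra.
rewrite leNgt; apply/negP => a0.
have ab : 0 < a + b by lra.
have := key (a / (a + b)); rewrite divr_gt0// ler_pdivrMr// mul1r lerDl b0.
move=> /(_ isT isT); rewrite mulrAC ler_pdivlMr// => h.
nra.
Qed.

End Projection.

(** * Moreau envelope of an indicator and expansion of the squared distance *)

Section Moreau.
Context {R : realType} {m : nat}.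
Variable D : set 'rV[R]_m.
Hypotheses (D0 : D !=set0) (clD : closed D).

Lemma moreau_indic b y : 0 < b ->
  moreau (indic_fun D) b y = (2 * b)^-1 * dist2 D y ^+ 2.
Proof.
move=> b0; have c0 : 0 <= (2 * b)^-1 by rewrite invr_ge0 mulr_ge0// ltW.
have [Dp pmin] := proj2P y D0 clD.
rewrite /moreau (_ : ereal_inf _ = ((2 * b)^-1 * dist2 D y ^+ 2)%:E)//.
apply/eqP; rewrite eq_le; apply/andP; split.
  apply: ereal_inf_lbound; exists (proj2 D y) => //.
  by rewrite /indic_fun mem_set// add0e -norm2N opprB dist2_proj2.
apply: le_ereal_inf_tmp => _ [u _ <-]; rewrite /indic_fun.
case: ifPn => [/set_mem Du|_]; last by rewrite addye// leey.
rewrite add0e lee_fin ler_wpM2l// ler_pXn2r ?nnegrE ?dist2_ge0 ?norm2_ge0//.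
by rewrite -norm2N opprB dist2_lb.
Qed.

(** The projection of [y] is a competitor for the distance from [y + h]. *)
Lemma dist2_sq_upper y h : dist2 D (y + h) ^+ 2 <=
  dist2 D y ^+ 2 + 2 * dotv (y - proj2 D y) h + dotv h h.
Proof.
have [Dp _] := proj2P y D0 clD.
apply: (@le_trans _ _ (norm2 (y + h - proj2 D y) ^+ 2)).
  by rewrite ler_pXn2r ?nnegrE ?dist2_ge0 ?norm2_ge0// dist2_lb.
rewrite dist2_proj2// !norm2_sq addrAC !(dotvDl _ h) !(dotvDr _ _ h).
by rewrite (dotvC h (y - _)); lra.
Qed.

(** With p, q the projections of y and y + h, expand the square of (y - p) + (h - (q - p)); the last
    square is dropped and the obtuse angle at p removes the term in q - p. *)
Lemma dist2_sq_lower y h : convex_set D ->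
  dist2 D y ^+ 2 + 2 * dotv (y - proj2 D y) h <= dist2 D (y + h) ^+ 2.
Proof.
move=> cD; have [Dp _] := proj2P (y + h) D0 clD.
have := proj2_obtuse y D0 clD cD Dp.
rewrite (dist2_proj2 y D0 clD) (dist2_proj2 (y + h) D0 clD) !norm2_sq.
set p := proj2 D y; set q := proj2 D (y + h) => pq.
have -> : y + h - q = (y - p) + (h - (q - p)).
  by apply/rowP => i; rewrite !mxE; ring.
have := dotv_ge0 (h - (q - p)).
rewrite [dotv (y - p + _) _]dotvDl 2!(dotvDr _ (y - p)).
rewrite (dotvC (h - _) (y - p)) (dotvDr (y - p) h) dotvNr.
by lra.
Qed.

End Moreau.

(** * Gradients of the Moreau envelope and of the smoothed objective *)

(** The difference quotient is within K |h| of c. This turns the two-sided bounds on the squared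
    distance into a directional derivative. *)
Lemma is_derive_quadratic (R : realType) (V : normedModType R) (F : V -> R)
    (x v : V) (c K : R) :
  (forall h : R, `|F (h *: v + x) - F x - h * c| <= K * h ^+ 2) ->
  is_derive x v F c.
Proof.
move=> FK; have K0 : 0 <= K.
  by have := FK 1; rewrite expr1n mulr1; exact: le_trans.
suff Fc : (fun h => h^-1 *: ((F \o shift x) (h *: v) - F x)) @ 0^' --> c.
  by apply: DeriveDef; [apply/cvg_ex; exists c|exact: cvg_lim].
apply/cvgrPdist_le => e e0; near=> h.
have h0 : h != 0 by near: h; exact: nbhs_dnbhs_neq.
rewrite distrC.
have -> : h^-1 *: ((F \o shift x) (h *: v) - F x) - c =
    h^-1 * (F (h *: v + x) - F x - h * c).
  by rewrite mulrBr mulKf.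
rewrite normrM normfV ler_pdivrMl ?normr_gt0// (le_trans (FK h))//.
rewrite -(real_normK (num_real h)) expr2 mulrA mulrC ler_wpM2l//.
(* The denominator K + 1 stays positive when K = 0. *)
have hs : `|h| < e / (K + 1).
  near: h; apply: dnbhs0_lt; rewrite divr_gt0// ltr_wpDl//.
move: hs; rewrite ltr_pdivlMr ?ltr_wpDl// => hs.
by have := normr_ge0 h; nra.
Unshelve. all: by end_near. Qed.

Section MoreauGrad.
Context {R : realType} {n m : nat}.
Variables (T : {linear 'rV[R]_n -> 'rV[R]_m}) (D : set 'rV[R]_m).
Hypotheses (D0 : D !=set0) (clD : closed D) (cD : convex_set D).

(** Composing with [T] from the start serves both the penalty in the smoothed objective and, with
    [T] the identity, the envelope itself. *)
Lemma is_derive_moreau b x v : 0 < b ->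
  is_derive x v (moreau (indic_fun D) b \o T)
    (b^-1 * dotv (T x - proj2 D (T x)) (T v)).
Proof.
move=> b0; have c0 : 0 < (2 * b)^-1 by rewrite invr_gt0 mulr_gt0.
have bE : b^-1 = (2 * b)^-1 * 2 by field; rewrite gt_eqF.
apply: (@is_derive_quadratic _ _ _ _ _ _ ((2 * b)^-1 * dotv (T v) (T v))) => h.
rewrite /= !moreau_indic// linearD linearZ addrC [h *: _ + _]addrC.
have := dist2_sq_upper D0 clD (T x) (h *: T v).
have := dist2_sq_lower D0 clD (T x) (h *: T v) cD.
rewrite !(dotvZr, dotvZl) bE.
set a := dist2 D (_ + _) ^+ 2; set d := dist2 D (T x) ^+ 2.
set p := dotv _ _; set q := dotv _ _ => lo hi.
have -> : - (h * ((2 * b)^-1 * 2 * p)) + ((2 * b)^-1 * a - (2 * b)^-1 * d) =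
  (2 * b)^-1 * (a - (d + 2 * (h * p))) by ring.
rewrite normrM gtr0_norm// -mulrA ler_wpM2l ?(ltW c0)// ger0_norm; lra.
Qed.

Lemma grad_moreau_comp b x : 0 < b ->
  grad (moreau (indic_fun D) b \o T) x =
  adjoint T (b^-1 *: (T x - proj2 D (T x))).
Proof.
move=> b0; apply/rowP => i; rewrite mxE.
have /@derive_val -> := is_derive_moreau x (delta_mx 0 i) b0.
by rewrite -dotv_delta dotv_adjoint dotvZr dotvC.
Qed.

End MoreauGrad.

Lemma grad_moreau (R : realType) m (D : set 'rV[R]_m) b y :
  D !=set0 -> closed D -> convex_set D -> 0 < b ->
  grad (moreau (indic_fun D) b) y = b^-1 *: (y - proj2 D y).
Proof.
move=> D0 clD cD b0; apply/rowP => i; rewrite mxE.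
have /@derive_val := @is_derive_moreau R m m idfun D D0 clD cD b y (delta_mx 0 i) b0.
rewrite -dotv_delta dotvZr dotvC /= => <-.
by congr derive.
Qed.

Lemma grad_smoothed_obj (R : realType) n m (f : 'rV[R]_n -> R)
    (T : {linear 'rV[R]_n -> 'rV[R]_m}) (D : set 'rV[R]_m) b x :
  D !=set0 -> closed D -> convex_set D -> 0 < b -> differentiable f x ->
  grad (smoothed_obj f T (indic_fun D) b) x =
  grad f x + adjoint T (b^-1 *: (T x - proj2 D (T x))).
Proof.
move=> D0 clD cD b0 df; rewrite -grad_moreau_comp//; apply/rowP => i.
rewrite !mxE -[smoothed_obj _ _ _ _]/(f + (moreau (indic_fun D) b \o T)).
rewrite deriveD//; first exact: diff_derivable.
by have /@ex_derive := is_derive_moreau T D0 clD cD x (delta_mx 0 i) b0.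
Qed.

(** * First-order upper bound for [f] along segments of the compact set *)

Section Descent.
Context {R : realType} {n : nat}.

Lemma derive_grad (f : 'rV[R]_n -> R) x v :
  differentiable f x -> 'D_v f x = dotv (grad f x) v.
Proof.
move=> df; rewrite deriveE// {1}(row_sum_delta v) linear_sum.
by apply: eq_bigr => i _; rewrite linearZ -deriveE// mxE mulrC.
Qed.

Lemma norm2_bounded (C : set 'rV[R]_n) : compact C ->
  exists2 d, 0 <= d & forall x y, C x -> C y -> norm2 (x - y) <= d.
Proof.
move=> /compact_bounded[M [_ CM]].
have CM1 z : C z -> norm2 z <= n%:R * (`|M| + 1).
  move=> Cz; apply: le_trans (ler_norm2_norm z) _; rewrite ler_wpM2l// CM//.
  by rewrite (le_lt_trans (ler_norm M))// ltrDl.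
exists (2 * (n%:R * (`|M| + 1))) => [|x y Cx Cy].
  by rewrite !mulr_ge0// addr_ge0.
have := norm2D x (- y); rewrite norm2N; have := CM1 _ Cx; have := CM1 _ Cy; lra.
Qed.

(** The mean value theorem gives the increment as t <grad f(x + s v), v> with 0 < s < t, and the
    Lipschitz bound compares this gradient with that at x. Bounding s by t yields the factor L, in
    place of the L / 2 given by integration. *)
Lemma segment_upper (C : set 'rV[R]_n) (f : 'rV[R]_n -> R) L x y (t : R) :
  convex_set C -> (forall z, C z -> differentiable f z) -> 0 <= L ->
  (forall u v, C u -> C v -> norm2 (grad f u - grad f v) <= L * norm2 (u - v)) ->
  C x -> C y -> 0 <= t <= 1 ->
  f (x + t *: (y - x)) <=
    f x + t * dotv (grad f x) (y - x) + L * t ^+ 2 * norm2 (y - x) ^+ 2.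
Proof.
move=> cC df L0 fL Cx Cy /andP[t0 t1]; set v := y - x.
have Cs s : 0 <= s <= t -> C (s *: v + x).
  move=> /andP[s0 st]; rewrite addrC; apply: convex_segment => //.
  by rewrite s0 (le_trans st).
pose F (s : R) := f (s *: v + x).
have dF s : 0 <= s <= t -> is_derive s 1 F (dotv (grad f (s *: v + x)) v).
  move=> st; have dfs := df _ (Cs s st).
  (* The difference quotients of [F] at [s] are those of [f] at [s *: v + x] along [v]. *)
  have FE : (fun h : R => h^-1 *: ((F \o shift s) (h *: 1) - F s)) =
     (fun h : R => h^-1 *: ((f \o shift (s *: v + x)) (h *: v) - f (s *: v + x))).
    apply/funext => h; rewrite /F /= [h *: 1]mulr1 scalerDl.
    by rewrite addrA.
  apply: DeriveDef; first by rewrite /derivable FE; exact: diff_derivable.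
  by rewrite /derive FE -derive_grad.
have [s| |s] := @MVT_segment R F (fun s => dotv (grad f (s *: v + x)) v) 0 t t0.
- by rewrite in_itv /= => /andP[s0 st]; apply: dF; rewrite !ltW.
- apply: derivable_within_continuous => s; rewrite in_itv /= => st.
  by have /@ex_derive := dF s st.
rewrite in_itv /= => /andP[s0 st]; rewrite /F scale0r add0r subr0 => FE.
have := cauchy_schwarz (grad f (s *: v + x) - grad f x) v.
have := fL _ _ (Cs s (introT andP (conj s0 st))) Cx.
rewrite addrK norm2Z ger0_norm// dotvDl dotvNl => h1 h2.
have hL : L * (s * norm2 v) * norm2 v <= L * (t * norm2 v) * norm2 v.
  by rewrite ler_wpM2r ?norm2_ge0// ler_wpM2l// ler_wpM2r ?norm2_ge0.
have := le_trans h2 (le_trans (ler_wpM2r (norm2_ge0 v) h1) hL).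
by rewrite addrC => /(ler_wpM2l t0); rewrite [x + _]addrC; lra.
Qed.

End Descent.

(** * Fourth roots and telescoping over the window *)

Lemma leq_half_succ N k : (N./2 <= k)%N -> (N <= 2 * k.+1)%N.
Proof. by lia. Qed.

Section Rates.
Context {R : realType}.

Lemma root4K (a : R) : 0 <= a -> (a `^ 4^-1) ^+ 4 = a.
Proof.
by move=> a0; rewrite -powR_mulrn ?powR_ge0// -powRrM mulVf// powRr1.
Qed.

Lemma powRN2inv (a : R) : a `^ (- 2^-1) = ((a `^ 4^-1) ^+ 2)^-1.
Proof.
rewrite powRN -powR_mulrn ?powR_ge0// -powRrM.
by have -> : 2^-1 = 4^-1 * 2 :> R by field.
Qed.

Lemma root4_ge1 k : 1 <= k.+1%:R `^ 4^-1 :> R.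
Proof.
rewrite -[leLHS](powRr0 k.+1%:R) ler_powR ?ler1n// invr_ge0 ler0n.
Qed.

Lemma telescope_ge (Psi : nat -> R) e a l :
  (forall k, (a <= k < a + l)%N -> e <= Psi k - Psi k.+1) ->
  l%:R * e <= Psi a - Psi (a + l)%N.
Proof.
elim: l => [|l IH] h; first by rewrite addn0 subrr mul0r.
have := h (a + l)%N; rewrite leq_addr addnS leqnn => /(_ isT).
have : l%:R * e <= Psi a - Psi (a + l)%N.
  apply: IH => k /andP[ak kl]; apply: h; rewrite ak addnS ltnW//.
by rewrite -[l.+1%:R]natr1 mulrDl mul1r; lra.
Qed.

(* Over the window [N/2, N) the recursion telescopes: with [p = N^(1/4)] the
   step sizes add up to at least [p^2 / 2], and the right-hand sides to [O(p)]. *)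
Lemma min_window_rate (gap Psi : nat -> R) (A F : R) (N c : nat) :
  let q k := k.+1%:R `^ 4^-1 in
  0 <= A -> 0 <= F ->
  (forall k, gap k / q k ^+ 2 <= Psi k - Psi k.+1 + A * q k / k.+1%:R) ->
  (forall i j, Psi i - Psi j <= F * q j) -> (2 <= N)%N ->
  (forall k, (N./2 <= k <= N.-1)%N -> gap c <= gap k) ->
  gap c <= 4 * (A + F) * (N%:R `^ 4^-1)^-1.
Proof.
move=> q A0 F0 step PsiF N2 cmin.
have hN : (N./2 <= N)%N by lia.
have Npos : 0 < N%:R :> R by rewrite ltr0n; apply: leq_trans N2.
set p := N%:R `^ 4^-1.
have p0 : 0 < p by exact: powR_gt0.
have p4 : p ^+ 4 = N%:R by apply: root4K; rewrite ltW.
(* A nonpositive smallest gap satisfies the bound at once; positivity is what permits dividing by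
   the larger p^2 below. *)
have [c0|c0] := leP (gap c) 0.
  by rewrite (le_trans c0)// mulr_ge0 ?invr_ge0 ?(ltW p0)// mulr_ge0// addr_ge0.
have q0 k : 0 < q k by exact: powR_gt0.
have qp k : (k < N)%N -> q k <= p.
  move=> kN; apply: ge0_ler_powR; rewrite ?nnegrE ?invr_ge0 ?ler0n ?ler_nat//.
pose e := gap c / p ^+ 2 - 2 * A * p / N%:R.
have estep k : (N./2 <= k < N./2 + (N - N./2))%N -> e <= Psi k - Psi k.+1.
  rewrite subnKC// => /andP[Nk kN].
  have ck : gap c / p ^+ 2 <= gap k / q k ^+ 2.
    apply: ler_pM; rewrite ?invr_ge0 ?exprn_ge0 ?(ltW c0) ?(ltW p0)//.
      by apply: cmin; rewrite Nk -ltnS prednK// (leq_trans _ N2).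
    rewrite lef_pV2 ?posrE ?exprn_gt0// ler_pXn2r ?nnegrE ?(ltW p0) ?(ltW (q0 _))//.
    exact: qp.
  have kk : A * q k / k.+1%:R <= 2 * A * p / N%:R.
    rewrite -mulrA [2 * A]mulrC -!mulrA ler_wpM2l//.
    rewrite ler_pdivrMr// mulrAC mulrCA [2 * _]mulrC -!mulrA.
    have Nk2 : N%:R <= 2 * k.+1%:R :> R.
      by rewrite -natrM ler_nat leq_half_succ.
    rewrite -[leLHS]mulr1 ler_pM ?ler01 ?(ltW (q0 k)) ?qp//.
    by rewrite mulrCA mulrA ler_pdivlMr// mul1r.
  by rewrite lerBlDr (le_trans ck)// (le_trans (step k))// lerD2l.
have := telescope_ge estep; rewrite subnKC// => tele.
have := le_trans tele (PsiF _ _).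
(* The telescoped sum ends at index N, where q is the fourth root of N + 1 <= 16 N. *)
have q2p : q N <= 2 * p.
  rewrite -(@ler_pXn2r _ 4) ?nnegrE ?mulr_ge0 ?(ltW p0) ?(ltW (q0 _))//.
  rewrite exprMn p4 root4K//.
  by rewrite -natrX -natrM ler_nat; lia.
have l1 : (N - N./2)%:R <= N%:R :> R by rewrite ler_nat leq_subr.
have l2 : N%:R <= 2 * (N - N./2)%:R :> R.
  by rewrite -natrM ler_nat; lia.
move: l1 l2; set l : R := (N - N./2)%:R => l1 l2 h.
have h2 : l * e <= 2 * F * p by rewrite (le_trans h)// [2 * F]mulrC -mulrA ler_wpM2l.
have h3 : l * (2 * A * p / N%:R) <= 2 * A * p.
  rewrite mulrCA -[leRHS]mulr1 ler_wpM2l ?mulr_ge0 ?(ltW p0)//.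
  by rewrite ler_pdivrMr// mul1r.
have h4 : p ^+ 2 / 2 * gap c <= l * (gap c / p ^+ 2).
  have -> : p ^+ 2 / 2 * gap c = p ^+ 4 / 2 * (gap c / p ^+ 2).
    by field; rewrite gt_eqF.
  rewrite ler_wpM2r ?divr_ge0 ?exprn_ge0 ?(ltW p0) ?(ltW c0)//.
  by rewrite p4; lra.
have h5 : p * (p * gap c) <= p * (4 * (A + F)).
  have : l * e = l * (gap c / p ^+ 2) - l * (2 * A * p / N%:R).
    by rewrite /e mulrBr.
  by move: h2 h3 h4; lra.
by rewrite ler_pM2l// mulrC -ler_pdivlMr// in h5.
Qed.

End Rates.

(** * Smoothed gap and one Frank-Wolfe step *)

Section Frames.
Context {R : realType} {n m : nat}.
Variables (C : set 'rV[R]_n) (f : 'rV[R]_n -> R).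
Variables (T : {linear 'rV[R]_n -> 'rV[R]_m}) (D : set 'rV[R]_m).
Hypotheses (cptC : compact C) (cC : convex_set C).
Hypothesis df : forall z, C z -> differentiable f z.
Hypotheses (D0 : D !=set0) (clD : closed D) (cD : convex_set D).

Let g := indic_fun D.

(** Identifies the gradient in the gap with the gradient of the objective that FRAMES linearises. *)
Lemma smoothed_gapE b z : 0 < b -> C z ->
  smoothed_gap C f T g b z =
  sup [set dotv (grad (smoothed_obj f T g b) z) (z - s) | s in C].
Proof.
move=> b0 Cz; rewrite /smoothed_gap grad_moreau// grad_smoothed_obj//.
exact: df.
Qed.

Lemma smoothed_gap_ge b z s : 0 < b -> C z -> C s ->
  dotv (grad (smoothed_obj f T g b) z) (z - s) <= smoothed_gap C f T g b z.
Proof.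
move=> b0 Cz Cs; rewrite smoothed_gapE//; set G := grad _ z.
have [d _ Cd] := norm2_bounded cptC.
apply: ub_le_sup; last by exists s.
exists (norm2 G * d) => _ [w Cw <-].
by rewrite (le_trans (cauchy_schwarz _ _))// ler_wpM2l ?norm2_ge0// Cd.
Qed.

Lemma smoothed_gap_le b z s : 0 < b -> C z ->
  argmin C (dotv (grad (smoothed_obj f T g b) z)) s ->
  smoothed_gap C f T g b z <= dotv (grad (smoothed_obj f T g b) z) (z - s).
Proof.
move=> b0 Cz [Cs smin]; rewrite smoothed_gapE//; apply: ge_sup.
  by exists (dotv (grad (smoothed_obj f T g b) z) (z - s)), s.
by move=> _ [w Cw <-]; rewrite !dotvDr !dotvNr lerD2l lerN2 smin.
Qed.

Lemma grad_smoothed_dotv b z v : 0 < b -> C z ->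
  dotv (grad (smoothed_obj f T g b) z) v =
  dotv (grad f z) v + b^-1 * dotv (T z - proj2 D (T z)) (T v).
Proof.
move=> b0 Cz; rewrite grad_smoothed_obj//; last exact: df.
by rewrite dotvDl [dotv (adjoint _ _) v]dotvC dotv_adjoint dotvZr (dotvC (T v)).
Qed.

(* With [p] the projection of [T z] on [D], [<T z - p, T z - T s>] splits into
   [|T z - p|^2] and [<T z - p, p - T s>], which is nonnegative as [T s] lies in
   [D]. *)
Lemma smoothed_gap_feasible b z s : 0 < b -> C z -> C s -> D (T s) ->
  dotv (grad f z) (z - s) + b^-1 * dist2 D (T z) ^+ 2 <=
  smoothed_gap C f T g b z.
Proof.
move=> b0 Cz Cs Ds; apply: le_trans (smoothed_gap_ge b0 Cz Cs).
rewrite grad_smoothed_dotv// lerD2l ler_wpM2l ?invr_ge0 ?(ltW b0)//.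
rewrite dist2_proj2// norm2_sq linearB.
have := proj2_obtuse (T z) D0 clD cD Ds.
set p := proj2 D _; have -> : T z - T s = (T z - p) - (T s - p).
  by apply/rowP => i; rewrite !mxE; ring.
by rewrite (dotvDr _ _ (- (T s - p))) dotvNr; lra.
Qed.

(** Adds the segment bound for [f] to the upper expansion of the squared distance at
    [t *: T (s - z)]; the envelope contributes the curvature K^2 / (2 b). *)
Lemma smoothed_obj_descent b z s t L K : 0 < b -> C z -> C s -> 0 <= t <= 1 ->
  0 <= L ->
  (forall u v, C u -> C v -> norm2 (grad f u - grad f v) <= L * norm2 (u - v)) ->
  (forall v, norm2 (T v) <= K * norm2 v) ->
  smoothed_obj f T g b (z + t *: (s - z)) <=
  smoothed_obj f T g b z - t * dotv (grad (smoothed_obj f T g b) z) (z - s) +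
  t ^+ 2 * (L + K ^+ 2 / (2 * b)) * norm2 (s - z) ^+ 2.
Proof.
move=> b0 Cz Cs t01 L0 fL TK.
have := segment_upper cC df L0 fL Cz Cs t01.
have := dist2_sq_upper D0 clD (T z) (t *: T (s - z)).
rewrite /smoothed_obj !moreau_indic// (linearD T z) linearZ => h1 h2.
rewrite -(opprB s z) dotvNr grad_smoothed_dotv//.
move: h1; rewrite dotvZr dotvZl dotvZr => h1.
have h3 : dotv (T (s - z)) (T (s - z)) <= K ^+ 2 * norm2 (s - z) ^+ 2.
  rewrite -norm2_sq -exprMn ler_pXn2r ?nnegrE ?norm2_ge0//.
  by rewrite (le_trans _ (TK _)) ?norm2_ge0.
have t2 : 0 <= t ^+ 2 by rewrite sqr_ge0.
have b2 : 0 <= (2 * b)^-1 by rewrite invr_ge0 mulr_ge0// ltW.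
have bE : b^-1 = (2 * b)^-1 * 2 by field; rewrite gt_eqF.
have h4 : t * (t * dotv (T (s - z)) (T (s - z))) <=
    t ^+ 2 * (K ^+ 2 * norm2 (s - z) ^+ 2).
  by rewrite mulrA -expr2 ler_wpM2l.
have := ler_wpM2l b2 (le_trans h1 (lerD (lexx _) h4)).
by rewrite bE; move: h2; set c := (2 * b)^-1; lra.
Qed.

End Frames.

(** * From the recursion to the rates of infeasibility and signed gap *)

(** If d exceeded (a + b + 1) t, then d >= t, so d^2 >= a t d + (b + 1) t^2, which contradicts the
    hypothesis. *)
Lemma quadratic_le (R : realType) (d t a b : R) : 0 <= d -> 0 < t -> 0 <= a ->
  0 <= b -> d ^+ 2 <= a * t * d + b * t ^+ 2 -> d <= (a + b + 1) * t.
Proof.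
move=> d0 t0 a0 b0 h; rewrite leNgt; apply/negP => dt.
have td : t <= d by rewrite (le_trans _ (ltW dt))// ler_peMl ?(ltW t0)//; lra.
have h1 : (a + b + 1) * t * d <= d * d by rewrite ler_wpM2r ?(ltW dt).
have h2 : (b + 1) * t * t <= (b + 1) * t * d.
  by rewrite ler_wpM2l// mulr_ge0 ?(ltW t0)//; lra.
have h3 : 0 < t * t by rewrite mulr_gt0.
by move: h h1 h2 h3; rewrite !expr2; lra.
Qed.

Theorem theorem6p4 (R : realType) (n m : nat)
  (C : set 'rV[R]_n) (f : 'rV[R]_n -> R)
  (T : {linear 'rV[R]_n -> 'rV[R]_m}) (D : set 'rV[R]_m)
  (kappa beta0 : R) (x : nat -> 'rV[R]_n) (kstar : nat -> nat) :
  let Ct : set 'rV[R]_n := C `&` T @^-1` D in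
  let g : 'rV[R]_m -> \bar R := indic_fun D in
  let gamma : nat -> R := fun k => k.+1%:R `^ (- 2^-1) in
  let beta : nat -> R := fun k => beta0 * k.+1%:R `^ (- 4^-1) in
  C !=set0 -> compact C -> convex_set C ->
  (exists U : set 'rV[R]_n,
    [/\ open U, C `<=` U & continuously_differentiable_on U f]) ->
  lipschitz2_on C (grad f) ->
  D !=set0 -> closed D -> convex_set D ->
  D `&` T @` C !=set0 ->
  0 < kappa ->
  (forall z, C z -> dist2 Ct z <= kappa * dist2 D (T z)) ->
  0 < beta0 ->
  frames C f T g gamma beta x ->
  (forall N : nat, (2 <= N)%N ->
    argmin [set k : nat | (N./2 <= k <= N.-1)%N]
      (fun k => smoothed_gap C f T g (beta k) (x k)) (kstar N)) ->
  (exists M : R, forall N : nat, (2 <= N)%N ->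
    dist2 D (T (x (kstar N))) <= M * N%:R `^ (- 4^-1)) /\
  (exists M : R, forall N : nat, (2 <= N)%N ->
    `| signed_gap Ct f (x (kstar N)) | <= M * N%:R `^ (- 4^-1)).
Proof.
move=> Ct g gamma beta C0 cptC cC [U [_ CU [dfU _]]] [L1 fL1] D0 clD cD.
move=> [y0 [Dy0 [c Cc Tc]]] kappa0 reg beta00 [Cx0 gamma01 beta_gt0 step] kmin.
have Dc : D (T c) by rewrite Tc.
have df z : C z -> differentiable f z by move=> /CU; exact: dfU.
have [d d0 Cd] := norm2_bounded cptC.
have [K K0 TK] := linear_norm2_bounded T.
(* The Lipschitz constant comes without a sign. *)
pose L := `|L1|; have L0 : 0 <= L by exact: normr_ge0.
have fL u v : C u -> C v -> norm2 (grad f u - grad f v) <= L * norm2 (u - v).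
  move=> Cu Cv; apply: le_trans (fL1 u v Cu Cv) _.
  by rewrite ler_wpM2r ?norm2_ge0// ler_norm.
(* A bound for the gradient on [C]: its norm at the feasible point [c], plus Lipschitz constant
   times diameter. *)
pose Gf := norm2 (grad f c) + L * d.
have Gf0 : 0 <= Gf by rewrite addr_ge0 ?norm2_ge0// mulr_ge0.
have gradf z v : C z -> dotv (grad f z) v <= Gf * norm2 v.
  move=> Cz; apply: le_trans (cauchy_schwarz _ _) _.
  rewrite ler_wpM2r ?norm2_ge0// -[grad f z](subrK (grad f c)).
  apply: le_trans (norm2D _ _) _; rewrite addrC lerD2l.
  by rewrite (le_trans (fL _ _ Cz Cc))// ler_wpM2l// Cd.
have gamk k : 0 <= gamma k <= 1.
  by have /andP[g0 g1] := gamma01 k; rewrite (ltW g0).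
have Cx k : C (x k).
  elim: k => // k Cxk; have [s [Cs _] ->] := step k.
  exact: convex_segment.
pose delta z := dist2 D (T z).
have delta0 z : 0 <= delta z by exact: dist2_ge0.
pose B := (K * d) ^+ 2.
have B0 : 0 <= B by exact: sqr_ge0.
have deltaB z : C z -> delta z ^+ 2 <= B.
  move=> Cz; rewrite ler_pXn2r ?nnegrE ?mulr_ge0//.
  apply: le_trans (dist2_lb (T z) Dc) _; rewrite -linearB (le_trans (TK _))//.
  by rewrite ler_wpM2l// Cd.
have fF u v : C u -> C v -> f u - f v <= Gf * d + L * d ^+ 2.
  move=> Cu Cv; have h01 : 0 <= (1 : R) <= 1 by rewrite ler01 lexx.
  have := segment_upper cC df L0 fL Cv Cu h01.
  rewrite scale1r [v + _]addrC subrK mul1r expr1n mulr1.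
  rewrite -addrA -lerBlDl => /le_trans; apply; apply: lerD.
    by rewrite (le_trans (gradf _ _ Cv))// ler_wpM2l// Cd.
  by rewrite ler_wpM2l// ler_pXn2r ?nnegrE ?norm2_ge0// Cd.
(* All sequences become powers of q: gamma_k = q_k^(-2), beta_k = beta0 / q_k and k + 1 = q_k^4. *)
pose q k : R := k.+1%:R `^ 4^-1.
have q1 k : 1 <= q k by exact: root4_ge1.
have q0 k : 0 < q k by exact: lt_le_trans (q1 k).
have q4 k : q k ^+ 4 = k.+1%:R by exact: root4K.
have betaE k : beta k = beta0 / q k by rewrite /beta powRN.
have betaV k : (2 * beta k)^-1 = q k / (2 * beta0).
  by rewrite betaE; field; rewrite !gt_eqF.
have b20 : 0 < (2 * beta0)^-1 by rewrite invr_gt0 mulr_gt0.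
pose gap k := smoothed_gap C f T g (beta k) (x k).
(* Since q_k >= 1, L <= L q_k, so the error of a step is at most A q_k / (k + 1). *)
pose A := (L + K ^+ 2 / (2 * beta0)) * d ^+ 2.
have A0 : 0 <= A.
  by rewrite mulr_ge0 ?exprn_ge0// addr_ge0// mulr_ge0 ?exprn_ge0// ltW.
(* Subtracting [B / (2 beta_k)] absorbs the growth of the penalty weight: as
   [delta ^+ 2 <= B], passing from [beta k] to [beta k.+1] decreases [Psi]. *)
pose Psi k := f (x k) + (delta (x k) ^+ 2 - B) * (q k / (2 * beta0)).
have recursion k : gap k / q k ^+ 2 <= Psi k - Psi k.+1 + A * q k / k.+1%:R.
  have [s smin xS] := step k; have Cs := proj1 smin.
  have := smoothed_obj_descent cC df D0 clD cD (beta_gt0 k) (Cx k) Cs (gamk k) L0 fL TK.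
  have := smoothed_gap_le df D0 clD cD (beta_gt0 k) (Cx k) smin.
  rewrite -xS /smoothed_obj !moreau_indic// -/g -/(gap k) -/(delta _) -/(delta _).
  rewrite betaV; set G := dotv _ _ => gapG descent.
  have gammaE : gamma k = (q k ^+ 2)^-1 by exact: powRN2inv.
  have gamma2 : gamma k ^+ 2 = k.+1%:R^-1 by rewrite gammaE exprVn -exprM q4.
  have gG : gamma k * gap k <= gamma k * G.
    by have /andP[g0 _] := gamk k; rewrite ler_wpM2l.
  have error : gamma k ^+ 2 * (L + K ^+ 2 * (q k / (2 * beta0))) *
      norm2 (s - x k) ^+ 2 <= A * q k / k.+1%:R.
    have Lq : L <= L * q k by rewrite ler_peMr.
    have Kq : 0 <= K ^+ 2 * (q k / (2 * beta0)).
      by rewrite mulr_ge0 ?exprn_ge0// mulr_ge0// ltW.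
    rewrite gamma2 -mulrA mulrC ler_wpM2r ?invr_ge0 ?ler0n//.
    have -> : A * q k = (L * q k + K ^+ 2 * (q k / (2 * beta0))) * d ^+ 2.
      by rewrite /A; ring.
    apply: ler_pM; rewrite ?exprn_ge0 ?norm2_ge0 ?addr_ge0 ?lerD2r//.
    by rewrite ler_pXn2r ?nnegrE ?norm2_ge0// Cd.
  have penalty : (delta (x k.+1) ^+ 2 - B) * (q k.+1 / (2 * beta0)) <=
      (delta (x k.+1) ^+ 2 - B) * (q k / (2 * beta0)).
    apply: ler_wnM2l; first by rewrite subr_le0 deltaB.
    rewrite ler_wpM2r ?(ltW b20)//.
    by apply: ge0_ler_powR; rewrite ?nnegrE ?invr_ge0 ?ler_nat.
  rewrite [leLHS]mulrC -gammaE /Psi.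
  move: descent error penalty gG; set e := A * q k / k.+1%:R.
  set w := q k / (2 * beta0); set w' := q k.+1 / (2 * beta0).
  set r := gamma k ^+ 2 * _ * _; set a := gamma k * gap k; set b := gamma k * G.
  lra.
(* The penalty part of [Psi i] is nonpositive and that of [Psi j] is at least - B q_j / (2 beta0);
   the variation of [f] is bounded on [C]. *)
have [F F0 PsiF] : exists2 F, 0 <= F & forall i j, Psi i - Psi j <= F * q j.
  exists (Gf * d + L * d ^+ 2 + B / (2 * beta0)) => [|i j].
    by rewrite !addr_ge0 ?mulr_ge0 ?exprn_ge0// ltW.
  have h1 : f (x i) - f (x j) <= (Gf * d + L * d ^+ 2) * q j.
    rewrite (le_trans (fF _ _ (Cx i) (Cx j)))// ler_peMr ?q1//.
    by rewrite addr_ge0// mulr_ge0// exprn_ge0.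
  have h2 : (delta (x i) ^+ 2 - B) * (q i / (2 * beta0)) <= 0.
    by rewrite mulr_le0_ge0 ?subr_le0 ?deltaB// mulr_ge0// ltW.
  have h3 : 0 <= delta (x j) ^+ 2 * (q j / (2 * beta0)).
    by rewrite mulr_ge0 ?sqr_ge0// mulr_ge0// ltW.
  by rewrite /Psi; lra.
have [M M0 gap_rate] : exists2 M, 0 <= M & forall N, (2 <= N)%N ->
    gap (kstar N) <= M * N%:R `^ (- 4^-1).
  exists (4 * (A + F)) => [|N N2]; first by rewrite mulr_ge0// addr_ge0.
  rewrite powRN; have [_ kN] := kmin N N2.
  exact: (min_window_rate A0 F0 recursion PsiF N2 kN).
have Ct0 : Ct !=set0 by exists c.
(* The distance to [Ct] is used as an infimum, hence the slack e; the tolerance e / (Gf + 1) costs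
   at most e after multiplication by Gf, even for Gf = 0. *)
have near_feasible z e : C z -> 0 < e -> exists2 s, Ct s &
    - (Gf * kappa * delta z) - e <= dotv (grad f z) (z - s).
  move=> Cz e0; have G1 : 0 < Gf + 1 by rewrite ltr_wpDl.
  have [s Cts sd] := dist2_adherent z Ct0 (divr_gt0 e0 G1); exists s => //.
  rewrite -opprD lerNl -dotvNr opprB (le_trans (gradf _ _ Cz))//.
  rewrite -norm2N opprB.
  have h1 := le_trans (ltW sd) (lerD (reg z Cz) (lexx _)).
  apply: le_trans (ler_wpM2l Gf0 h1) _.
  have : Gf * (e / (Gf + 1)) <= e.
    by rewrite mulrCA ler_piMr ?(ltW e0)// ler_pdivrMr// mul1r lerDl.
  by rewrite mulrDr /delta; set y := e / _; lra.
have delta_rate N : (2 <= N)%N -> delta (x (kstar N)) <=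
    (2 * beta0 * Gf * kappa + 2 * beta0 * M + 1) * N%:R `^ (- 4^-1).
  move=> N2; have := gap_rate N N2; set t := N%:R `^ _ => gapN.
  have t0 : 0 < t by rewrite powR_gt0// ltr0n (leq_trans _ N2).
  set k := kstar N in gapN *; set z := x k.
  (* The window starts at N/2, so N <= 2 (k + 1) <= 16 (k + 1), and the fourth root of N is at most
     2 q_k. *)
  have betak : beta k <= 2 * beta0 * t.
    have Np : 0 < N%:R `^ 4^-1 :> R by rewrite powR_gt0// ltr0n (leq_trans _ N2).
    have Nq : N%:R `^ 4^-1 <= 2 * q k.
      rewrite -(@ler_pXn2r _ 4) ?nnegrE ?mulr_ge0 ?(ltW Np) ?(ltW (q0 k))//.
      rewrite exprMn q4 root4K// -natrX -natrM ler_nat.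
      have [/andP[/leq_half_succ Nk _] _] := kmin N N2.
      by rewrite (leq_trans Nk)// leq_mul2r orbT.
    rewrite betaE /t powRN [2 * _]mulrC -mulrA ler_wpM2l ?(ltW beta00)//.
    by rewrite ler_pdivlMr// mulrC ler_pdivrMr.
  (* The feasible test point bounds delta^2 / beta_k up to e, and e is arbitrary. *)
  have h : delta z ^+ 2 <= beta k * (gap k + Gf * kappa * delta z).
    rewrite -ler_pdivrMl//; apply/ler_addgt0Pr => e e0.
    have [s [Cs Ds] hs] := near_feasible z e (Cx k) e0.
    have := smoothed_gap_feasible cptC df D0 clD cD (beta_gt0 k) (Cx k) Cs Ds.
    rewrite -/g -/(gap k) -/z -/(delta z); lra.
  have W0 : 0 <= Gf * kappa * delta z by rewrite !mulr_ge0// ltW.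
  (* Here a = 2 beta0 Gf kappa and b = 2 beta0 M. *)
  apply: quadratic_le => //; rewrite ?mulr_ge0// ?(ltW beta00) ?(ltW kappa0)//.
  apply: le_trans h _.
  apply: le_trans (ler_wpM2l (ltW (beta_gt0 k)) (lerD gapN (lexx _))) _.
  have W1 : 0 <= M * t + Gf * kappa * delta z by rewrite addr_ge0// mulr_ge0// ltW.
  have := ler_wpM2r W1 betak; rewrite expr2; lra.
split; first by eexists; exact: delta_rate.
set M1 := (_ + 1) in delta_rate.
exists (M + Gf * kappa * M1) => N N2.
have := gap_rate N N2; have := delta_rate N N2.
set t := N%:R `^ _; set k := kstar N; set z := x k => dN gN.
have t0 : 0 < t by rewrite powR_gt0// ltr0n (leq_trans _ N2).
have GM : Gf * kappa * delta z <= Gf * kappa * M1 * t.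
  by rewrite -[leRHS]mulrA ler_wpM2l// mulr_ge0// ltW.
have W0 : 0 <= Gf * kappa * delta z by rewrite !mulr_ge0// ltW.
(* The nonnegative term delta^2 / beta_k is dropped; the same bound also makes the supremum
   meaningful for the lower estimate. *)
have ub : ubound [set dotv (grad f z) (z - s) | s in Ct] (M * t).
  move=> _ [s [Cs Ds] <-]; apply: le_trans gN.
  have := smoothed_gap_feasible cptC df D0 clD cD (beta_gt0 k) (Cx k) Cs Ds.
  apply: le_trans; rewrite lerDl mulr_ge0 ?sqr_ge0// invr_ge0 ltW//.
have Mt : 0 <= M * t by rewrite mulr_ge0// ltW.
rewrite ler_norml; apply/andP; split.
  apply/ler_addgt0Pr => e e0; have [s Cts hs] := near_feasible z e (Cx k) e0.
  have : dotv (grad f z) (z - s) <= signed_gap Ct f z.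
    by apply: ub_le_sup; [exists (M * t)|exists s].
  by rewrite mulrDl; lra.
apply: (@le_trans _ _ (M * t)); last by rewrite mulrDl; lra.
apply: ge_sup => //; by exists (dotv (grad f z) (z - c)), c.
Qed.
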